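(* Let $R=\mathbb{C}[x,y,z]$ and $J=(yz(y-z),\,zx(z-x),\,xy(x-y))\subseteq R$. Then (1) $\widehat{\alpha}(J)=\frac{5}{2}$; (2) $\alpha(J^{(2k)})=5k$ for all $k\ge 2$; (3) $\alpha(J^{(2k+1)})=5k+3$ for all $k\ge 0$; (4) $\alpha(J^{(2)})=6$.
   Context: For a homogeneous ideal $I$, $\alpha(I)$ denotes the least degree of a nonzero homogeneous element of $I$; $I^{(m)}=\bigcap_{\mathfrak p\in \operatorname{Ass}(R/I)} (I^mR_{\mathfrak p}\cap R)$ is the $m$-th symbolic power (with $I^{(1)}=I$); $\widehat{\alpha}(I)=\lim_{m\to\infty}\alpha(I^{(m)})/m$ is the Waldschmidt constant. *)

(* Defs.v *)
(* mpoly (multinomials) over the complex numbers,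
   realised as [complex R] for an arbitrary [R : realType] (any realType is
   a model of the real numbers, so [complex R] is a model of C). *)
From Stdlib Require Import ClassicalEpsilon.
From mathcomp Require Import all_boot all_algebra.
From mathcomp Require Import reals.
From mathcomp.real_closed Require Import complex.
From mathcomp Require Import mpoly.
Import GRing.Theory Num.Theory.

Set Implicit Arguments.
Unset Strict Implicit.
Unset Printing Implicit Defensive.

Local Open Scope ring_scope.

Section Defs.
Variable R : realType.

Definition Cxyz := {mpoly (complex R)[3]}.

Definition ideal := Cxyz -> Prop.

Definition is_ideal (I : ideal) : Prop :=
  [/\ I 0, (forall f g, I f -> I g -> I (f + g)) &
      (forall a f, I f -> I (a * f))].

Definition gen_ideal (S : Cxyz -> Prop) : ideal :=
  fun f => exists s : seq (Cxyz * Cxyz),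
    (forall pq, pq \in s -> S pq.2) /\ f = \sum_(pq <- s) pq.1 * pq.2.

Definition prod_ideal (I K : ideal) : ideal :=
  gen_ideal (fun h => exists a b, [/\ I a, K b & h = a * b]).

Fixpoint pow_ideal (I : ideal) (m : nat) : ideal :=
  match m with
  | 0 => gen_ideal (fun h => h = 1)
  | m'.+1 => prod_ideal I (pow_ideal I m')
  end.

Definition prime_ideal (P : ideal) : Prop :=
  [/\ is_ideal P, ~ P 1 & forall a b, P (a * b) -> P a \/ P b].

Definition ass (I : ideal) (P : ideal) : Prop :=
  prime_ideal P /\ exists g : Cxyz, forall h, P h <-> I (h * g).

(* I^m R_P \cap R = { f | exists s \notin P, s f \in I^m } (R a domain). *)
Definition loc_contract (I : ideal) (m : nat) (P : ideal) : ideal :=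
  fun f => exists s, ~ P s /\ pow_ideal I m (s * f).

Definition symb_pow (I : ideal) (m : nat) : ideal :=
  if m == 1%N then I
  else fun f => forall P, ass I P -> loc_contract I m P f.

Definition is_alpha (I : ideal) (d : nat) : Prop :=
  (exists f, [/\ I f, f != 0 & f \is d.-homog]) /\
  (forall f e, I f -> f != 0 -> f \is e.-homog -> (d <= e)%N).

(* alpha(I) (well defined, by classical choice, whenever I has a nonzero
   homogeneous element). *)
Definition alpha (I : ideal) : nat := epsilon (inhabits 0%N) (is_alpha I).

Definition waldschmidt_is (I : ideal) (c : R) : Prop :=
  forall eps : R, 0 < eps -> exists N : nat, forall m : nat, (0 < m)%N -> (N <= m)%N ->
    `| (alpha (symb_pow I m))%:R / m%:R - c | < eps.

Definition Jideal : ideal :=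
  let x : Cxyz := 'X_0 in let y : Cxyz := 'X_1 in let z : Cxyz := 'X_2 in
  gen_ideal (fun h => h = y * z * (y - z) \/ h = z * x * (z - x) \/ h = x * y * (x - y)).

End Defs.

(* Main.v *)
(** [J] is the ideal of the seven points of P^2 whose coordinates are 0 or 1.
    Modulo [J] a monomial depends only on its support and its degree, and
    restricting to the line through the indicator vector of [S] sums the
    coefficients over the supports contained in [S]; by inclusion-exclusion [J]
    is radical, and its associated primes are the ideals of the seven points.

    Lower bound. Four of the points lie on three of the six lines
    x y z (x - y) (y - z) (z - x) = 0, the other three on two of them. The
    quartics that are double at those three points and pass through the other
    four form a pencil of rational curves, and one of them goes through a
    generic point q. Pulling back a form of degree d vanishing to order m at the
    seven points gives a polynomial of degree at most 4 d with ten roots of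
    multiplicity m (two for each node), so that f (q) <> 0 forces 4 d >= 10 m.
    For m = 2 and d = 5 each of the six lines contains three of the points,
    hence f vanishes on all of them, so it vanishes on a generic line.

    Upper bound. Suitable products of lines have order m at the seven points. *)

Require Import Defs.
From mathcomp Require Import all_boot all_order all_algebra ring zify.
From mathcomp Require Import reals.
From mathcomp.real_closed Require Import complex.
From mathcomp Require Import mpoly.
Import Order.TTheory GRing.Theory Num.Theory.
Set Implicit Arguments.
Unset Strict Implicit.
Unset Printing Implicit Defensive.
Local Open Scope ring_scope.

(** * Restriction of forms to polynomial curves *)

Lemma size_mul_le (F : nzRingType) (p q : {poly F}) d e :
  (size p <= d.+1 -> size q <= e.+1 -> size (p * q)%R <= (d + e).+1)%N.
Proof.
move=> sp sq; apply: leq_trans (size_polyMleq _ _) _.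
by have := leq_add sp sq; rewrite addSn addnS; case: (_ + _)%N.
Qed.

Section Curves.
Variables (n : nat) (F : fieldType).
Implicit Types (f : {mpoly F[n]}) (g : 'I_n -> {poly F}).

Lemma horner_mmap g f t :
  (mmap polyC g f).[t] = f.@[fun i => (g i).[t]].
Proof.
rewrite mevalE /mmap horner_sum; apply: eq_bigr => m _.
rewrite hornerM hornerC /mmap1 horner_prod; congr (_ * _).
by apply: eq_bigr => i _; rewrite horner_exp.
Qed.

Lemma size_mmap_homog d e g f : f \is d.-homog ->
  (forall i, size (g i) <= e.+1)%N -> (size (mmap polyC g f) <= (d * e).+1)%N.
Proof.
move=> /dhomogP fd sg; rewrite /mmap.
apply: (leq_trans (size_sum _ _ _)); apply/bigmax_leqP_seq => m mf _.
rewrite mul_polyC; apply: (leq_trans (size_scale_leq _ _)).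
rewrite -(fd _ mf) /= mdegE big_distrl /= /mmap1.
apply: (big_ind2 (fun (p : {poly F}) k => is_true (size p <= k.+1)%N)) => [|p k q l|i _].
- by rewrite size_poly1.
- exact: size_mul_le.
- elim: (m i) => [|k IH]; first by rewrite expr0 size_poly1.
  by rewrite exprS mulSn size_mul_le.
Qed.

Lemma mmap_scale_homog d c g f : f \is d.-homog ->
  mmap polyC (fun i => c *: g i) f = c ^+ d *: mmap polyC g f.
Proof.
move=> /dhomogP fd; rewrite /mmap scaler_sumr.
apply: eq_big_seq => m mf; rewrite scalerAr; congr (_ * _).
rewrite -(fd _ mf) /= mdegE /mmap1 -prodrXr -scaler_prod.
by apply: eq_bigr => i _; rewrite exprZn.
Qed.

Lemma meval_scale_homog d c (v : 'I_n -> F) f : f \is d.-homog ->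
  f.@[fun i => c * v i] = c ^+ d * f.@[v].
Proof.
move=> /dhomogP fd; rewrite !mevalE mulr_sumr.
apply: eq_big_seq => m mf; rewrite mulrCA; congr (_ * _).
rewrite -(fd _ mf) /= mdegE -prodrXr -big_split.
by apply: eq_bigr => i _; rewrite exprMn.
Qed.

End Curves.

(** Powers of distinct linear factors are coprime, so their product divides [G]; a nonzero [G] would
    have smaller degree than this product. *)
Lemma dvdp_exp_roots_eq0 (F : fieldType) m (rs : seq F) (G : {poly F}) : uniq rs ->
  {in rs, forall t, ('X - t%:P) ^+ m %| G} -> (size G <= m * size rs)%N -> G = 0.
Proof.
move=> urs dG sG; apply/eqP; apply: contraTT sG => G0; rewrite -ltnNge.
suff /(dvdp_leq G0) : \prod_(t <- rs) ('X - t%:P) ^+ m %| G.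
  apply: leq_trans; rewrite prodrXl -[ltnRHS]prednK.
    by rewrite ltnS size_exp size_prod_XsubC mulnC.
  by rewrite size_poly_gt0 expf_neq0 // monic_neq0 // monic_prod_XsubC.
elim: rs urs dG => [|t rs IH] /=; first by rewrite big_nil dvd1p.
move=> /andP[trs urs] dG; rewrite big_cons Gauss_dvdp.
  by rewrite dG ?mem_head // IH // => s srs; rewrite dG // inE srs orbT.
rewrite coprimep_expl // prodrXl coprimep_expr //.
by rewrite coprimep_sym coprimep_XsubC root_prod_XsubC.
Qed.

(** * Points where a nonzero polynomial does not vanish *)

Section CharZero.
Variable F : numFieldType.

Lemma poly_nonroot (p : {poly F}) : p != 0 -> exists x, p.[x] != 0.
Proof.
move=> p0; pose rs : seq F := [seq k%:R | k <- iota 0 (size p)].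
have [|/allPn[x _ xp]] := boolP (all (root p) rs); last by exists x.
move=> /(max_poly_roots p0); rewrite map_inj_uniq ?iota_uniq; last first.
  by move=> i j /eqP; rewrite eqr_nat => /eqP.
by move=> /(_ isT); rewrite size_map size_iota ltnn.
Qed.

Lemma exists_notin (s : seq F) : exists x, x \notin s.
Proof.
have [|x] := @poly_nonroot (\prod_(t <- s) ('X - t%:P)).
  by rewrite monic_neq0 // monic_prod_XsubC.
by rewrite -[_.[x] == 0]/(root _ x) root_prod_XsubC; exists x.
Qed.

Lemma digits_inj n N (a b : 'I_n -> nat) :
    (forall i, a i < N)%N -> (forall i, b i < N)%N ->
  (\sum_i a i * N ^ i = \sum_i b i * N ^ i)%N -> a =1 b.
Proof.
elim: n a b => [|n IH] a b aN bN; first by move=> _ [].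
rewrite !big_ord_recl !expn0 !muln1 /=.
have shift (c : 'I_n.+1 -> nat) :
    (\sum_(i < n) c (lift ord0 i) * N ^ bump 0 i
     = (\sum_(i < n) c (lift ord0 i) * N ^ i) * N)%N.
  by rewrite big_distrl; apply: eq_bigr => i _; rewrite /= expnSr mulnA.
rewrite !shift => E.
have E0 : a ord0 = b ord0.
  by move: (congr1 (modn^~ N) E); rewrite ![(_ + _ * N)%N]addnC !modnMDl !modn_small.
have N0 : (0 < N)%N by apply: leq_ltn_trans (aN ord0).
move: E; rewrite E0 => /addnI/eqP; rewrite eqn_pmul2r // => /eqP /IH E1 i.
by have [j ->|->] := unliftP ord0 i; first exact: E1.
Qed.

(* Kronecker substitution: monomials of small degree get distinct powers. *)
Lemma mpoly_nonroot n (f : {mpoly F[n]}) : f != 0 -> exists v, f.@[v] != 0.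
Proof.
move=> f0; have := f0; rewrite -msupp_eq0.
case E: (msupp f) => [//|m0 ms] _; have m0f : m0 \in msupp f.
  by rewrite E mem_head.
pose N := msize f; pose g (i : 'I_n) : {poly F} := 'X^(N ^ i).
have g1 m : mmap1 g m = 'X^(\sum_i m i * N ^ i)%N.
  by rewrite /mmap1 -prodrXr; apply: eq_bigr => i _; rewrite -exprM mulnC.
have small m : m \in msupp f -> forall i, (m i < N)%N.
  move=> mf i; apply: leq_ltn_trans (msize_mdeg_lt mf).
  by rewrite mdegE (bigD1 i) //= leq_addr.
have [|x fx] := @poly_nonroot (mmap polyC g f); last first.
  by rewrite horner_mmap in fx; eexists; exact: fx.
apply: contraTneq m0f => /(congr1 (fun p : {poly F} => p`_(\sum_i m0 i * N ^ i)%N)).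
rewrite coef0 /mmap coef_sum (bigD1_seq m0) ?msupp_uniq //=; last first.
  by rewrite E mem_head.
rewrite g1 coefCM coefXn eqxx mulr1 big_seq_cond big1 ?addr0 => [|m].
  by move=> fm0; rewrite mcoeff_msupp fm0 eqxx.
case/andP=> mf; apply: contraNeq; rewrite g1 coefCM coefXn.
case: (_ =P \sum_i _)%N => [E1 _|_]; last by rewrite mulr0n mulr0 eqxx.
apply/eqP/mnmP => i; apply: (digits_inj _ _ (esym E1)) => j; apply: small => //.
by rewrite E mem_head.
Qed.
End CharZero.

(** * Three coordinates and the cone over the seven points *)

Lemma ord3P (Q : 'I_3 -> Prop) : Q 0 -> Q 1 -> Q 2 -> forall i, Q i.
Proof.
move=> Q0 Q1 Q2 [[|[|[|//]]] lti].
- by rewrite (_ : Ordinal lti = 0) //; apply: val_inj.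
- by rewrite (_ : Ordinal lti = 1) //; apply: val_inj.
- by rewrite (_ : Ordinal lti = 2) //; apply: val_inj.
Qed.

Lemma big_ord3 (T : Type) (idx : T) (op : Monoid.law idx) (E : 'I_3 -> T) :
  \big[op/idx]_i E i = op (E 0) (op (E 1) (E 2)).
Proof.
rewrite !big_ord_recl big_ord0 Monoid.mulm1.
by congr (op _ (op _ _)); congr E; apply: val_inj.
Qed.

Definition vec (T : Type) (a b c : T) (i : 'I_3) : T := nth c [:: a; b] i.

Section Cone.
Variable F : fieldType.

(** The affine cone over the seven points, without its vertex. *)
Definition on_cone (v : 'I_3 -> F) := exists (S : {set 'I_3}) c,
  [/\ S != set0, c != 0 & forall i, v i = c * (i \in S)%:R].

Definition cone_at (b : bool * bool * bool) (v : 'I_3 -> F) :=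
  exists2 c, c != 0 &
    [/\ v 0 = c * b.1.1%:R, v 1 = c * b.1.2%:R & v 2%:R = c * b.2%:R].

Lemma cone_at_on_cone b v : b != (false, false, false) -> cone_at b v -> on_cone v.
Proof.
case: b => -[b0 b1] b2 b [c c0 /= [v0 v1 v2]].
exists [set i | vec b0 b1 b2 i], c; split=> //; last by apply: ord3P; rewrite inE.
by apply/set0Pn; case: b0 b1 b2 b {v0 v1 v2} => -[] [] //= _;
  [exists 0|exists 0|exists 0|exists 0|exists 1|exists 1|exists 2%:R]; rewrite inE.
Qed.

Lemma cone_at_inj b b' v : cone_at b v -> cone_at b' v -> b = b'.
Proof.
move=> [c c0 [v0 v1 v2]] [c' c'0]; rewrite v0 v1 v2 => -[].
have E (a a' : bool) : c * a%:R = c' * a'%:R -> a = a'.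
  by case: a a' => -[] //; rewrite mulr0 mulr1 => /eqP;
    rewrite ?(negbTE c0) // eq_sym (negbTE c'0).
move=> /E E0 /E E1 /E E2.
by case: b b' E0 E1 E2 {v0 v1 v2} => -[? ?] ? [[? ?] ?] /= -> -> ->.
Qed.

End Cone.

(** * The pencil of rational quartics *)

(* The standard Cremona involution with fundamental points (0,1,1), (1,0,1),
   (1,1,0) sends the pencil of quartics to the conics
   a^2 - r b^2 + (r - 1) c^2 = 0, parametrized here by the lines through
   (1,1,1); the third factors are a, b, c, up to order and sign. *)
Definition quartic (A : comNzRingType) (r p q : A) : 'I_3 -> A :=
  vec ((r - 1) * p * q * (p ^+ 2 - r * q ^+ 2))
      (r * q * (p - q) * (p ^+ 2 + r * q ^+ 2 - 2%:R * p * q))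
      (p * (p - q) * (2%:R * r * p * q - p ^+ 2 - r * q ^+ 2)).

Lemma quarticZ (A : comNzRingType) (r p q k : A) i :
  quartic r (k * p) (k * q) i = k ^+ 4 * quartic r p q i.
Proof. by move: i; apply: ord3P; rewrite /quartic /vec /=; ring. Qed.

Lemma horner_quartic (F : fieldType) (r t : F) (p q : {poly F}) i :
  (quartic r%:P p q i).[t] = quartic r p.[t] q.[t] i.
Proof. by move: i; apply: ord3P; rewrite /quartic /vec /= !hornerE. Qed.

Lemma size_quartic (F : fieldType) (r : F) (p q : {poly F}) i :
  (size p <= 2 -> size q <= 2 -> size (quartic r%:P p q i) <= 5)%N.
Proof.
move=> sp sq.
have sD (a b : {poly F}) n : (size a <= n -> size b <= n -> size (a + b)%R <= n)%N.
  by move=> sa sb; rewrite (leq_trans (size_polyD _ _)) // geq_max sa.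
have sN (a : {poly F}) n : (size a <= n -> size (- a)%R <= n)%N by rewrite size_polyN.
have sC (c : F) : (size c%:P <= 1)%N by apply: size_polyC_leq1.
have s1 : (size (1 : {poly F})%R <= 1)%N by rewrite size_poly1.
have s2 : (size (2%:R : {poly F})%R <= 1)%N by rewrite -polyC_natr.
have spq : (size (p - q)%R <= 2)%N by apply: sD => //; apply: sN.
have sr : (size (r%:P - 1)%R <= 1)%N by apply: sD => //; apply: sN.
have sM (a b : {poly F}) := @size_mul_le F a b.
have sX (a : {poly F}) : (size a <= 2 -> size (a ^+ 2)%R <= 3)%N.
  by move=> sa; rewrite expr2; apply: (sM _ _ 1 1).
have sCM (c a : {poly F}) n : (size c <= 1 -> size a <= n.+1 -> size (c * a)%R <= n.+1)%N.
  by move=> sc sa; apply: (sM _ _ 0 n).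
have s11 (a b : {poly F}) : (size a <= 2 -> size b <= 2 -> size (a * b)%R <= 3)%N.
  exact: (sM _ _ 1 1).
have s22 (a b : {poly F}) : (size a <= 3 -> size b <= 3 -> size (a * b)%R <= 5)%N.
  exact: (sM _ _ 2 2).
have p2 := sX _ sp; have q2 := sCM _ _ _ (sC r) (sX _ sq).
have sp' := sCM _ _ _ s2 sp.
have sr2 : (size (2%:R * r%:P)%R <= 1)%N by apply: (sCM _ _ 0%N).
move: i; apply: ord3P; rewrite /quartic /vec /=; apply: (s22).
- by apply: (s11) => //; apply: (sCM).
- by apply: (sD) => //; apply: (sN).
- by apply: (s11) => //; apply: (sCM).
- by apply: (sD); [apply: (sD) | apply: (sN); apply: (s11)].
- exact: s11.
- by apply: (sD); [apply: (sD); [apply: (s11); [apply: (sCM) |] | apply: (sN)] | apply: (sN)].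
Qed.

(** The ten special parameters and the one of the prescribed point are all made finite, so that
    polynomials in one variable suffice. *)
Lemma quartic_curve (F : numClosedFieldType) (r p0 q0 : F) :
    r != 0 -> r != 1 -> (p0, q0) != (0, 0) ->
  exists (g : 'I_3 -> {poly F}) (ts : seq F),
  [/\ forall i, (size (g i) <= 5)%N, uniq ts, size ts = 10,
      forall t, t \in ts -> on_cone (fun i => (g i).[t]) &
      exists t0 c, c != 0 /\ forall i, (g i).[t0] = c * quartic r p0 q0 i].
Proof.
move=> r0 r1 pq0; have r1' : r - 1 != 0 by rewrite subr_eq0.
(* With [q = 1] the quadratic factors of the three coordinates vanish at [s, - s], at [1 + b, 1 - b]
   and at [r + a, r - a]: the branches at the nodes (0,1,1), (1,0,1) and (1,1,0). *)
have [[s Es] [a Ea] [b Eb]] : [/\ exists s : F, s ^+ 2 = r, exists a : F, a ^+ 2 = r ^+ 2 - r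
    & exists b : F, b ^+ 2 = 1 - r].
  by split; eexists; exact: sqrtCK.
have two0 : 2%:R != 0 :> F by rewrite pnatr_eq0.
have s0 : s != 0 by apply: contraNneq r0 => s0; rewrite -Es s0 expr0n.
have a0 : a != 0.
  apply: contraNneq (mulf_neq0 r0 r1') => a0; apply/eqP.
  by transitivity (a ^+ 2); [rewrite Ea; ring | rewrite a0 expr0n].
have b0 : b != 0.
  by apply: contraNneq r1' => b0; rewrite -oppr_eq0 opprB -Eb b0 expr0n.
(* The ten parameters, as points of the projective line: four simple points of
   the curve, then the two branches at each node. *)
pose L := [:: (0, 1); (1, 0); (1, 1); (r, 1); (s, 1); (- s, 1);
              (r + a, 1); (r - a, 1); (1 + b, 1); (1 - b, 1)] : seq (F * F).
(* A change of coordinate on the projective line, [k] being chosen so that none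
   of the parameters is at infinity. *)
have [k kL] := exists_notin [seq pq.2 / pq.1 | pq <- (p0, q0) :: L].
have kpq pq : pq \in (p0, q0) :: L -> pq != (0, 0) -> k * pq.1 - pq.2 != 0.
  move=> pqL; apply: contraNneq => /eqP; rewrite subr_eq0 => /eqP E.
  have [p1|p1] := eqVneq pq.1 0; first by case: pq p1 E {pqL} => /= _ q -> <-; rewrite mulr0.
  by case/negP: kL; apply/mapP; exists pq => //; rewrite -E mulfK.
(* The inverse of t |-> (t : k t - 1), the parametrization used in [g]. *)
pose tau (pq : F * F) := pq.1 / (k * pq.1 - pq.2).
pose g := quartic r%:P 'X (k%:P * 'X - 1).
have gtau pq i : pq \in (p0, q0) :: L -> pq != (0, 0) ->
    (g i).[tau pq] = (k * pq.1 - pq.2) ^- 4 * quartic r pq.1 pq.2 i.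
  move=> pqL pqn0; have h0 := kpq _ pqL pqn0.
  rewrite horner_quartic !hornerE -exprVn -quarticZ; congr (quartic _ _ _ i).
    by rewrite mulrC.
  by rewrite /tau /=; field.
have /allP Ln0 : all (fun pq => pq != (0, 0)) L.
  by rewrite /= !xpair_eqE !oner_eq0 ?andbF.
have taucone (c : F) pq (b' : bool * bool * bool) : pq \in L -> c != 0 ->
    [/\ quartic r pq.1 pq.2 0 = c * b'.1.1%:R, quartic r pq.1 pq.2 1 = c * b'.1.2%:R &
        quartic r pq.1 pq.2 2%:R = c * b'.2%:R] ->
    cone_at b' (fun i => (g i).[tau pq]).
  move=> pqL c0 [E0 E1 E2]; have pqL' : pq \in (p0, q0) :: L by rewrite inE pqL orbT.
  exists ((k * pq.1 - pq.2) ^- 4 * c).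
    by rewrite mulf_neq0 // invr_neq0 // expf_neq0 // kpq ?Ln0.
  by rewrite !gtau ?Ln0 // E0 E1 E2 !mulrA.
have tau_inj u v : (u, 1) \in L -> (v, 1) \in L -> u != v -> tau (u, 1) != tau (v, 1).
  move=> uL vL; apply: contra_neq; rewrite /tau => /eqP.
  have h0 w : (w, 1) \in L -> k * w - 1 != 0.
    by move=> wL; apply: (kpq (w, 1)); rewrite ?Ln0 // inE wL orbT.
  rewrite /= eqr_div ?h0 // => /eqP E.
  by rewrite (_ : u = u * k * v - u * (k * v - 1)); [rewrite E|]; ring.
have cone_neq t t' (c c' : bool * bool * bool) : cone_at c (fun i => (g i).[t]) ->
    cone_at c' (fun i => (g i).[t']) -> c != c' -> t != t'.
  by move=> Kt Kt'; apply: contra_neq => tt'; rewrite tt' in Kt; exact: cone_at_inj Kt Kt'.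
have r2 : r ^+ 2 != r.
  by rewrite -subr_eq0 expr2 -[X in _ - X]mulr1 -mulrBr mulf_neq0.
have nz (c : F) : c != 0 -> 2%:R * c != 0 by move=> c0; rewrite mulf_neq0.
have K1 : cone_at (false, true, false) (fun i => (g i).[tau (0, 1)]).
  apply: (@taucone (- r ^+ 2)); rewrite ?inE ?eqxx ?orbT ?oppr_eq0 ?expf_neq0 //.
  by rewrite /quartic /vec /=; split; ring.
have K2 : cone_at (false, false, true) (fun i => (g i).[tau (1, 0)]).
  apply: (@taucone (- 1)); rewrite ?inE ?eqxx ?orbT ?oppr_eq0 ?oner_eq0 //.
  by rewrite /quartic /vec /=; split; ring.
have K3 : cone_at (true, false, false) (fun i => (g i).[tau (1, 1)]).
  apply: (@taucone (- (r - 1) ^+ 2)); rewrite ?inE ?eqxx ?orbT ?oppr_eq0 ?expf_neq0 //.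
  by rewrite /quartic /vec /=; split; ring.
have K4 : cone_at (true, true, true) (fun i => (g i).[tau (r, 1)]).
  apply: (@taucone ((r * (r - 1)) ^+ 2)); rewrite ?inE ?eqxx ?orbT ?expf_neq0 ?mulf_neq0 //.
  by rewrite /quartic /vec /=; split; ring.
have Kx u : (u, 1) \in L -> u ^+ 2 = r ->
    cone_at (false, true, true) (fun i => (g i).[tau (u, 1)]).
  move=> uL Eu.
  have u0 : u != 0 by apply: contraNneq r0 => u0; rewrite -Eu u0 expr0n.
  have u1 : u - 1 != 0.
    by rewrite subr_eq0; apply: contraNneq r1 => u1; rewrite -Eu u1 expr1n.
  apply: (@taucone (2%:R * (r * (u * (u - 1) ^+ 2)))) => //.
    by rewrite nz // mulf_neq0 // mulf_neq0 // expf_neq0.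
  by rewrite /quartic /vec /= -Eu; split; ring.
have Kz u : (u, 1) \in L -> u ^+ 2 = 2%:R * r * u - r ->
    cone_at (true, true, false) (fun i => (g i).[tau (u, 1)]).
  move=> uL Eu.
  have u0 : u != 0.
    apply: contraNneq r0 => u0; apply/eqP; transitivity (2%:R * r * u - u ^+ 2).
      by rewrite Eu; ring.
    by rewrite u0; ring.
  have u1 : u - 1 != 0.
    rewrite subr_eq0; apply: contraNneq r1 => u1; apply/eqP.
    transitivity (2%:R * r * u - r); first by rewrite u1; ring.
    by rewrite -Eu u1; ring.
  apply: (@taucone (2%:R * (r * ((r - 1) * (u * (u - 1)))))) => //.
    by rewrite nz // mulf_neq0 // mulf_neq0 // mulf_neq0.
  by rewrite /quartic /vec /=; split; ring: Eu.
have Ky u : (u, 1) \in L -> u ^+ 2 = 2%:R * u - r ->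
    cone_at (true, false, true) (fun i => (g i).[tau (u, 1)]).
  move=> uL Eu.
  have u0 : u != 0.
    apply: contraNneq r0 => u0; apply/eqP; transitivity (2%:R * u - u ^+ 2).
      by rewrite Eu; ring.
    by rewrite u0; ring.
  have ur : u - r != 0.
    rewrite subr_eq0; apply: contraNneq r2 => ur; apply/eqP.
    transitivity (2%:R * u - r); first by rewrite -Eu ur.
    by rewrite ur; ring.
  apply: (@taucone (2%:R * ((r - 1) * (u * (u - r))))) => //.
    by rewrite nz // mulf_neq0 // mulf_neq0.
  by rewrite /quartic /vec /=; split; ring: Eu.
have sL : (s, 1) \in L by rewrite !inE eqxx !orbT.
have sNL : (- s, 1) \in L by rewrite !inE eqxx !orbT.
have aL : (r + a, 1) \in L by rewrite !inE eqxx !orbT.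
have aNL : (r - a, 1) \in L by rewrite !inE eqxx !orbT.
have bL : (1 + b, 1) \in L by rewrite !inE eqxx !orbT.
have bNL : (1 - b, 1) \in L by rewrite !inE eqxx !orbT.
have K5 := Kx _ sL Es.
have K6 := Kx _ sNL (etrans (sqrrN s) Es).
have /(Kz _ aL) K7 : (r + a) ^+ 2 = 2%:R * r * (r + a) - r by ring: Ea.
have /(Kz _ aNL) K8 : (r - a) ^+ 2 = 2%:R * r * (r - a) - r by ring: Ea.
have /(Ky _ bL) K9 : (1 + b) ^+ 2 = 2%:R * (1 + b) - r by ring: Eb.
have /(Ky _ bNL) K10 : (1 - b) ^+ 2 = 2%:R * (1 - b) - r by ring: Eb.
have neqN (u v : F) : u != 0 -> v + u != v - u.
  by move=> u0; rewrite -subr_eq0 (_ : _ - _ = 2%:R * u) ?nz //; ring.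
have ssN : s != - s by have := neqN s 0 s0; rewrite add0r sub0r.
have N1 := tau_inj _ _ sL sNL ssN.
have N2 := tau_inj _ _ aL aNL (neqN _ _ a0).
have N3 := tau_inj _ _ bL bNL (neqN _ _ b0).
exists g, [seq tau pq | pq <- L]; split=> //.
- by move=> i; apply: size_quartic; rewrite ?size_polyX //;
     rewrite (leq_trans (size_polyD _ _)) // size_polyN size_poly1 geq_max andbT mul_polyC
       (leq_trans (size_scale_leq _ _)) ?size_polyX.
(* Parameters of different points differ by [cone_neq]; only the two branches at each node need the
   injectivity of [tau]. *)
- rewrite /= !inE !negb_or /= -!andbA.
  repeat (apply/andP; split); first [assumption | by [] |
    match goal with
    | K : cone_at _ (fun i => (g i).[?t]), K' : cone_at _ (fun i => (g i).[?t'])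
      |- is_true (?t != ?t') => exact: cone_neq K K' isT
    end].
- move=> t /mapP[pq pqL ->]; move: pqL; rewrite !inE -?orbA.
  by do ![case/orP => [/eqP->|]]; last move=> /eqP->;
    match goal with
    | K : cone_at _ (fun i => (g i).[?t]) |- on_cone (fun i => (g i).[?t]) =>
       exact: cone_at_on_cone K
    end.
- exists (tau (p0, q0)), ((k * p0 - q0) ^- 4); split=> [|i].
    by rewrite invr_neq0 // expf_neq0 // (kpq (p0, q0)) ?mem_head.
  by apply: gtau => //; exact: mem_head.
Qed.

(** * Ideal powers and their localizations *)

Section Ideals.
Variable R : realType.
Implicit Types (I K P : ideal R) (f g h : Cxyz R).

Lemma ideal_sum I (T : Type) (r : seq T) (Q : pred T) (E : T -> Cxyz R) :
  is_ideal I -> (forall i, Q i -> I (E i)) -> I (\sum_(i <- r | Q i) E i).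
Proof. by move=> [I0 ID _] IE; elim/big_ind: _. Qed.

Lemma gen_ideal_min (S : Cxyz R -> Prop) I f :
  is_ideal I -> (forall g, S g -> I g) -> gen_ideal S f -> I f.
Proof.
move=> idI SI [s [Ss ->]]; elim: s Ss => [|pq s IH] Ss.
  by rewrite big_nil; case: idI.
rewrite big_cons; have [_ ID IM] := idI.
apply: ID; first by apply: IM; apply/SI/Ss/mem_head.
by apply: IH => pq' pq's; apply: Ss; rewrite inE pq's orbT.
Qed.

Lemma gen_ideal_ideal (S : Cxyz R -> Prop) : is_ideal (gen_ideal S).
Proof.
split.
- by exists [::]; rewrite big_nil.
- move=> _ _ [s [Ss ->]] [t [St ->]]; exists (s ++ t); rewrite big_cat; split=> //.
  by move=> pq; rewrite mem_cat => /orP[/Ss|/St].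
- move=> a _ [s [Ss ->]]; exists [seq (a * pq.1, pq.2) | pq <- s]; split.
    by move=> _ /mapP[pq /Ss Spq ->].
  by rewrite big_map mulr_sumr; apply: eq_bigr => pq _; rewrite mulrA.
Qed.

Lemma mem_gen_ideal (S : Cxyz R -> Prop) f : S f -> gen_ideal S f.
Proof.
move=> Sf; exists [:: (1, f)]; split; last by rewrite big_seq1 mul1r.
by move=> pq; rewrite inE => /eqP ->.
Qed.

Lemma pow_ideal_ideal I m : is_ideal (pow_ideal I m).
Proof. by case: m => [|m]; exact: gen_ideal_ideal. Qed.

(** For fixed [g] the [f] satisfying the conclusion form an ideal, so generators suffice. *)
Lemma pow_idealM I m n f g :
  pow_ideal I m f -> pow_ideal I n g -> pow_ideal I (m + n) (f * g).
Proof.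
have idl k := pow_ideal_ideal I k.
elim: m f => [|m IH] f If Ig; first by have [_ _ IM] := idl n; exact: IM.
have idK : is_ideal (fun f => pow_ideal I (m.+1 + n) (f * g)).
  have [I0 ID IM] := idl (m.+1 + n)%N; split=> [|p q|p q].
  - by rewrite mul0r.
  - by rewrite mulrDl; exact: ID.
  - by rewrite -mulrA; exact: IM.
apply: (gen_ideal_min idK _ If) => _ [a [b [Ia Ib ->]]].
by apply: mem_gen_ideal; exists a, (b * g); rewrite mulrA; split=> //; exact: IH.
Qed.

Lemma pow_ideal1 I f : I f -> pow_ideal I 1 f.
Proof.
move=> If; apply: mem_gen_ideal; exists f, 1; rewrite mulr1; split=> //.
exact: mem_gen_ideal.
Qed.

Lemma prime_ideal_notM P f g : prime_ideal P -> ~ P f -> ~ P g -> ~ P (f * g).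
Proof. by move=> [_ _ primeP] nPf nPg /primeP []. Qed.

Lemma loc_contract0 I P f : prime_ideal P -> loc_contract I 0 P f.
Proof.
move=> [_ P1 _]; exists 1; split=> //.
by have [_ _ IM] := pow_ideal_ideal I 0; rewrite mulrC; apply: IM; exact: mem_gen_ideal.
Qed.

Lemma loc_contract1 I P f : prime_ideal P -> I f -> loc_contract I 1 P f.
Proof. by move=> [_ P1 _] If; exists 1; split=> //; rewrite mul1r; exact: pow_ideal1. Qed.

Lemma loc_contractM I P m n f g : prime_ideal P ->
  loc_contract I m P f -> loc_contract I n P g -> loc_contract I (m + n) P (f * g).
Proof.
move=> primeP [s [Ps Isf]] [t [Pt Itg]]; exists (s * t).
by split; [exact: prime_ideal_notM | rewrite mulrACA; exact: pow_idealM].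
Qed.

(** [symb_pow] sets [m = 1] apart; there the denominator 1 serves for every prime. *)
Lemma symb_pow_loc I m f P : symb_pow I m f -> ass I P -> loc_contract I m P f.
Proof.
rewrite /symb_pow; case: eqP => [-> If [primeP _]|_ If]; last exact: If.
exact: loc_contract1.
Qed.

End Ideals.

(** * Radicality and associated primes of [J] *)

Section Fano.
Variable R : realType.
Local Notation C := (complex R).
Local Notation J := (@Jideal R).
Implicit Types (f g h : Cxyz R) (S T : {set 'I_3}).

(** Restriction to the line through the indicator vector of [S]. *)
Local Notation res S := (mmap polyC (fun i => (i \in S)%:R *: 'X : {poly C})).
Local Notation x := ('X_0 : Cxyz R).
Local Notation y := ('X_1 : Cxyz R).
Local Notation z := ('X_2 : Cxyz R).

Lemma J_ideal : is_ideal J.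
Proof. exact: gen_ideal_ideal. Qed.

Lemma JM f g : J g -> J (f * g).
Proof. by have [_ _ IM] := J_ideal; exact: IM. Qed.

Lemma JD f g : J f -> J g -> J (f + g).
Proof. by have [_ ID _] := J_ideal; exact: ID. Qed.

Lemma Jyz : J (y * z * (y - z)).
Proof. by apply: mem_gen_ideal; left. Qed.
Lemma Jzx : J (z * x * (z - x)).
Proof. by apply: mem_gen_ideal; right; left. Qed.
Lemma Jxy : J (x * y * (x - y)).
Proof. by apply: mem_gen_ideal; right; right. Qed.

Lemma J_eval_eq0 (A : comNzRingType) (phi : {rmorphism Cxyz R -> A}) f :
  phi (y * z * (y - z)) = 0 -> phi (z * x * (z - x)) = 0 ->
  phi (x * y * (x - y)) = 0 -> J f -> phi f = 0.
Proof.
move=> E1 E2 E3; apply: (@gen_ideal_min _ _ (fun f => phi f = 0)); last first.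
  by move=> _ [->|[->|->]].
split; first exact: rmorph0.
- by move=> p q p0 q0; rewrite rmorphD p0 q0 addr0.
- by move=> a p p0; rewrite rmorphM p0 mulr0.
Qed.

(** Of two coordinates of a 0/1 vector, one is zero or both are equal. *)
Lemma J_res_eq0 f : J f -> forall S, res S f = 0.
Proof.
move=> Jf S; apply: J_eval_eq0 Jf; rewrite /= !rmorphM rmorphB /= !mmapX !mmap1U;
  by do 2!case: (_ \in S);
     rewrite ?scale1r ?scale0r ?subrr ?sub0r ?mul0r ?mulr0 ?mul0r.
Qed.

(* Modulo [J] the power [b] can be moved from [v] to [u] until one [v] is left. *)
Lemma J_exchange (u v : Cxyz R) a b : J (u * v * (u - v)) ->
  J (u ^+ a.+1 * v ^+ b.+1 - u ^+ (a + b).+1 * v).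
Proof.
move=> Juv; elim: b a => [|b IH] a; first by rewrite addn0 expr1 subrr; case: J_ideal.
rewrite (_ : _ - _ = - (u ^+ a * v ^+ b) * (u * v * (u - v)) +
   (u ^+ a.+2 * v ^+ b.+1 - u ^+ (a.+1 + b).+1 * v)).
  by apply: JD => //; apply: JM.
by rewrite addnS addSn !exprS; ring.
Qed.

(** The representative of support [T] and degree [n]: every variable of the support but the first
    has exponent 1. The last branch also gives 1 for empty [T] in degree 0. *)
Definition nf (T : {set 'I_3}) n : Cxyz R :=
  if 0 \in T then x ^+ (n - (1 \in T) - (2 \in T)) * y ^+ (1 \in T) * z ^+ (2 \in T)
  else if 1 \in T then y ^+ (n - (2 \in T)) * z ^+ (2 \in T) else z ^+ n.

Definition msup (m : 'X_{1..3}) : {set 'I_3} := [set i | m i != 0%N].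

Lemma mdeg3 (m : 'X_{1..3}) : mdeg m = (m 0%R + (m 1%R + m 2%R))%N.
Proof. by rewrite mdegE big_ord3. Qed.

Lemma J_nf (m : 'X_{1..3}) : J ('X_[m] - nf (msup m) (mdeg m)).
Proof.
rewrite mpolyXE_id big_ord3 mdeg3 /nf !inE.
case: (m 0) (m 1) (m 2) => [|a] [|b] [|c] /=;
 rewrite ?expr0 ?mul1r ?mulr1 ?add0n ?addn0 ?subn0 ?subrr; try by case: J_ideal.
- by rewrite addSn addnS subn1 /=; apply: J_exchange; exact: Jyz.
- rewrite addSn addnS subn1 /=; apply: J_exchange.
  rewrite (_ : _ * _ = - 1 * (z * x * (z - x))); last by ring.
  by apply: JM; exact: Jzx.
- by rewrite addSn addnS subn1 /=; apply: J_exchange; exact: Jxy.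
rewrite (_ : (_ - 1 - 1)%N = (a + (b + c)).+1)%N; last first.
  by rewrite !addSn !addnS !subn1.
(* First the surplus of [z] goes to [y], then that of [y] to [x]. *)
rewrite (_ : _ - _ = x ^+ a.+1 * (y ^+ b.+1 * z ^+ c.+1 - y ^+ (b + c).+1 * z) +
  z * (x ^+ a.+1 * y ^+ (b + c).+1 - x ^+ (a + (b + c)).+1 * y)); last by ring.
apply: JD; apply: JM; apply: J_exchange; [exact: Jyz | exact: Jxy].
Qed.

Lemma coef_res S f n :
  (res S f)`_n =
  \sum_(m <- msupp f | (msup m \subset S) && (mdeg m == n)) f@_m.
Proof.
rewrite /mmap coef_sum [RHS]big_mkcond /=; apply: eq_bigr => m _.
rewrite coefCM /mmap1 (_ : \prod_i _ = (msup m \subset S)%:R *: 'X^(mdeg m)).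
  rewrite coefZ coefXn eq_sym; case: (_ \subset S) => /=; last by rewrite mul0r mulr0.
  by rewrite mul1r; case: (_ == _); rewrite ?mulr1 ?mulr0.
have [/subsetP mS|/subsetPn[j]] := boolP (msup m \subset S); last first.
  rewrite inE => mi iS; rewrite scale0r (bigD1 j) //= (negbTE iS) scale0r.
  by rewrite expr0n (negbTE mi) mul0r.
rewrite scale1r mdegE -prodrXr; apply: eq_bigr => i _.
have [->|mi] := eqVneq (m i) 0%N; first by rewrite !expr0.
by rewrite mS ?inE // scale1r.
Qed.

(** Inclusion-exclusion as induction on [#|T|]: a coefficient of [res T f] sums the classes of all
    subsets of [T], and those of proper subsets already vanish. *)
Lemma sum_class_eq0 f : (forall S, res S f = 0) ->
  forall T n, \sum_(m <- msupp f | (msup m == T) && (mdeg m == n)) f@_m = 0.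
Proof.
move=> resf T n; have [k] := ubnP #|T|; elim: k T => // k IH T Tk.
have := congr1 (fun p : {poly C} => p`_n) (resf T); rewrite /= coef0 coef_res.
rewrite (partition_big msup (fun S => S \subset T)) => [|m /andP[] //].
rewrite (bigD1 T) //= [X in _ + X]big1 ?addr0 => [E|S /andP[ST nST]].
  rewrite -[RHS]E; apply: eq_bigl => m; have [->|_] := eqVneq (msup m) T; last by rewrite andbF.
  by rewrite subxx andbT.
rewrite -[RHS](IH S); last first.
  by rewrite -ltnS (leq_trans _ Tk) // ltnS proper_card // properEneq nST.
apply: eq_bigl => m; have [->|_] := eqVneq (msup m) S; last by rewrite andbF.
by rewrite ST andbT.
Qed.

Lemma res_eq0_J f : (forall S, res S f = 0) -> J f.
Proof.
move=> resf; pose N := (msize f).+1.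
have small m : m \in msupp f -> (mdeg m < N)%N.
  by move=> /msize_mdeg_lt/leqW.
suff nf0 : \sum_(m <- msupp f) f@_m *: nf (msup m) (mdeg m) = 0.
  rewrite -[f]subr0 -nf0 [X in X - _]mpolyE -sumrB.
  apply: (ideal_sum _ J_ideal) => m _; rewrite -scalerBr -mul_mpolyC.
  exact/JM/J_nf.
rewrite (partition_big (fun m => (msup m, inord (mdeg m) : 'I_N)) predT) //=.
apply: big1 => -[T k] _.
transitivity (\sum_(m <- msupp f | (msup m == T) && (mdeg m == k)) f@_m *: nf T k).
  rewrite big_seq_cond [RHS]big_seq_cond.
  apply: eq_big => [m|m /andP[mf /eqP[<- <-]]]; last by rewrite inordK ?small.
  have [mf /=|//] := boolP (m \in msupp f).
  by rewrite xpair_eqE -[in RHS](inordK (small _ mf)).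
by rewrite -scaler_suml sum_class_eq0 // scale0r.
Qed.

Lemma horner_res S f t : (res S f).[t] = f.@[fun i => t * (i \in S)%:R].
Proof.
by rewrite horner_mmap; apply: meval_eq => i; rewrite hornerZ hornerX mulrC.
Qed.

(** The empty set sees only the value at the origin, which lies on the line of the full set. *)
Lemma res_points_J f : (forall S, S != set0 -> res S f = 0) -> J f.
Proof.
move=> resf; apply: res_eq0_J => S; have [->|] := eqVneq S set0; last exact: resf.
apply/eqP; apply/negP => /negP/poly_nonroot[t]; apply/negP; rewrite negbK.
rewrite horner_res (meval_eq (v2 := fun i => 0 * (i \in [set: 'I_3])%:R)).
  by rewrite -horner_res resf ?horner0 // -card_gt0 cardsT card_ord.
by move=> i; rewrite inE mulr0 mul0r.
Qed.

(** The first product kills every [T] that misses an index of [S], the second every [T] containing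
    [i0] and an index outside [S]. *)
Lemma separator S : S != set0 ->
  exists2 g : Cxyz R, res S g != 0 & forall T, T != S -> res T g = 0.
Proof.
case/set0Pn => i0 i0S.
exists (\prod_(i in S) 'X_i * \prod_(j in ~: S) ('X_i0 - 'X_j)).
  rewrite rmorphM /= !rmorph_prod mulf_neq0 //=; apply/prodf_neq0 => i.
    by move=> iS; rewrite mmapX mmap1U iS scale1r polyX_eq0.
  rewrite inE => /negbTE iS; rewrite rmorphB /= !mmapX !mmap1U iS i0S.
  by rewrite scale1r scale0r subr0 polyX_eq0.
move=> T; rewrite eqEsubset negb_and rmorphM /= !rmorph_prod /= => TS.
apply/eqP; rewrite mulf_eq0; have [i0T|i0T] := boolP (i0 \in T); last first.
  apply/orP; left; apply/eqP; rewrite (bigD1 i0) //= mmapX mmap1U (negbTE i0T).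
  by rewrite scale0r mul0r.
case/orP: TS => /subsetPn[j jT jS]; apply/orP; [right|left].
  rewrite (bigD1 j) ?inE //= rmorphB /= !mmapX !mmap1U jT i0T.
  by rewrite subrr mul0r.
by rewrite (bigD1 j) //= mmapX mmap1U (negbTE jS) scale0r mul0r.
Qed.

Lemma res_prime S : prime_ideal (fun f => res S f = 0).
Proof.
split=> [||a b /eqP]; last by rewrite rmorphM mulf_eq0 => /orP[] /eqP; auto.
- split; first exact: rmorph0.
    by move=> f g f0 g0; rewrite rmorphD /= f0 g0 addr0.
  by move=> a f f0; rewrite rmorphM /= f0 mulr0.
- by move/eqP; rewrite rmorph1 oner_eq0.
Qed.

(** The prime of [S] is [J : g] for a separator [g], since [J] is cut out by the seven
    restrictions. *)
Lemma ass_res S : S != set0 -> ass J (fun f => res S f = 0).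
Proof.
move=> S0; split; first exact: res_prime.
have [g gS gT] := separator S0; exists g => h; split=> [hS|/J_res_eq0/(_ S)/eqP].
  apply: res_points_J => T _; rewrite rmorphM /=.
  by have [->|/gT ->] := eqVneq T S; rewrite ?hS ?mul0r ?mulr0.
by rewrite rmorphM mulf_eq0 (negbTE gS) orbF => /eqP.
Qed.

(** If [P = J : g] is proper, [g] is nonzero on the line of some [S], so [P] lies in the prime of
    [S]. Conversely, for [f] in that prime, a separator of [S] is outside [P] but its product with
    [f] is in [J]. *)
Lemma assP P : ass J P ->
  exists2 S, S != set0 & forall f, P f <-> res S f = 0.
Proof.
move=> [primeP [g Pg]]; have [[_ _ PM] P1 Pprime] := primeP.
have [S S0 gS] : exists2 S, S != set0 & res S g != 0.
  have [/existsP[S /andP[]]|] := boolP [exists S, (S != set0) && (res S g != 0)].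
    by exists S.
  rewrite negb_exists => /forallP gS; case: P1; apply/Pg; rewrite mul1r.
  by apply: res_points_J => S S0; apply/eqP; move: (gS S); rewrite S0 negbK.
exists S => // f.
have PS h : P h -> res S h = 0.
  move/Pg/J_res_eq0/(_ S)/eqP; rewrite rmorphM mulf_eq0 (negbTE gS) orbF.
  by move/eqP.
split; first exact: PS.
move=> fS; have [s sS sT] := separator S0.
have [|/PS s0|//] := @Pprime s f; last by rewrite s0 eqxx in sS.
apply/Pg; rewrite mulrC; apply: JM; apply: res_points_J => T _; rewrite rmorphM /=.
by have [->|/sT ->] := eqVneq T S; rewrite ?fS ?mul0r ?mulr0.
Qed.

(** * Vanishing order of symbolic powers along curves *)

Lemma pow_J_dvd m h (g : 'I_3 -> {poly C}) t : on_cone (fun i => (g i).[t]) ->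
  pow_ideal J m h -> ('X - t%:P) ^+ m %| mmap polyC g h.
Proof.
move=> [S [c [_ _ gt]]].
have idK k : is_ideal (fun h => ('X - t%:P) ^+ k %| mmap polyC g h).
  split; first by rewrite rmorph0 dvdp0.
    by move=> p q p0 q0; rewrite rmorphD dvdp_addr.
  by move=> a p p0; rewrite rmorphM dvdp_mull.
elim: m h => [|m IH] h; first by rewrite expr0 dvd1p.
apply: (gen_ideal_min (idK _)) => _ [a [b [Ja Jb ->]]].
rewrite rmorphM exprS dvdp_mul ?IH // dvdp_XsubCl /root horner_mmap.
by rewrite (meval_eq _ gt) -horner_res J_res_eq0 ?horner0.
Qed.

(** Once the denominator is nonzero at [t], its pullback is coprime to ['X - t%:P], so the whole
    power divides the pullback of [f]. *)
Lemma symb_pow_dvd d m f (g : 'I_3 -> {poly C}) t :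
    f \is d.-homog -> symb_pow J m f -> on_cone (fun i => (g i).[t]) ->
  ('X - t%:P) ^+ m %| mmap polyC g f.
Proof.
move=> fd Jf [S [c [S0 c0 gt]]].
have [s [/eqP sS Jsf]] := symb_pow_loc Jf (ass_res S0).
(* [s] is not homogeneous: rescale the curve so that it misses [s = 0] at [t]. *)
have [|b] := @poly_nonroot _ ('X * res S s); first by rewrite mulf_neq0 ?polyX_eq0.
rewrite hornerM hornerX mulf_eq0 negb_or => /andP[b0 sb].
pose a := b / c; pose ga i := a *: g i.
have gat i : (ga i).[t] = b * (i \in S)%:R.
  by rewrite hornerZ gt mulrA divfK.
have := @pow_J_dvd _ _ ga t _ Jsf; rewrite rmorphM /= mulrC.
rewrite Gauss_dvdpl; last first.
  rewrite coprimep_expl // coprimep_sym coprimep_XsubC /root horner_mmap.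
  by rewrite (meval_eq _ gat) -horner_res.
rewrite (mmap_scale_homog _ _ fd) dvdpZr ?expf_neq0 ?mulf_neq0 ?invr_eq0 //.
apply; exists S, b; split=> //.
Qed.

(** Bezout on a rational curve: the roots, with multiplicity, outnumber the degree of the
    pullback. *)
Lemma symb_pow_curve d m e f (g : 'I_3 -> {poly C}) (ts : seq C) :
    f \is d.-homog -> symb_pow J m f -> (forall i, size (g i) <= e.+1)%N ->
    uniq ts -> (forall t, t \in ts -> on_cone (fun i => (g i).[t])) ->
  (d * e < m * size ts)%N -> mmap polyC g f = 0.
Proof.
move=> fd Jf sg uts ton dm.
apply: (dvdp_exp_roots_eq0 (m := m) uts) => [t /ton|]; first exact: symb_pow_dvd fd Jf.
exact: leq_trans (size_mmap_homog fd sg) dm.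
Qed.

(** * Linear forms with integer coefficients *)

Definition lin (c : int * int * int) : Cxyz R :=
  c.1.1%:~R * x + c.1.2%:~R * y + c.2%:~R * z.

Lemma meval_lin c v :
  (lin c).@[v] = c.1.1%:~R * v 0 + c.1.2%:~R * v 1 + c.2%:~R * v 2%:R.
Proof. by rewrite /lin !rmorphD !rmorphM /= !rmorph_int !mevalXU. Qed.

Lemma lin_homog c : lin c \is 1.-homog.
Proof.
have H k i : (k%:~R * 'X_i : Cxyz R) \is 1.-homog.
  by rewrite mulrzl rpredMz // dhomogX /= mdeg1.
by rewrite !rpredD.
Qed.

Lemma lin_prod_homog s : \prod_(c <- s) lin c \is (size s).-homog.
Proof.
elim: s => [|c s IH]; first by rewrite big_nil dhomog1.
by rewrite big_cons; exact: dhomogM (lin_homog c) IH.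
Qed.

Lemma lin_neq0 c : c != (0, 0, 0) -> lin c != 0.
Proof.
case: c => -[a b] d; apply: contraNneq => E.
have co i : (lin (a, b, d)).@[fun j => (j == i)%:R] = 0 by rewrite E meval0.
move: (co 0) (co 1) (co 2%:R); rewrite !meval_lin /= !mulr1 !mulr0 !addr0 !add0r.
by do 3!(move=> /eqP; rewrite intr_eq0 => /eqP->).
Qed.

Lemma lin_prod_neq0 s : (0, 0, 0) \notin s -> \prod_(c <- s) lin c != 0.
Proof.
move=> s0; rewrite big_seq; apply: (big_ind (fun f => f != 0)); first exact: oner_neq0.
  by move=> f g f0 g0; rewrite mulf_neq0.
by move=> c cs; apply: lin_neq0; apply: contraNneq s0 => <-.
Qed.

Lemma generic_point f (s : seq (int * int * int)) : f != 0 -> (0, 0, 0) \notin s ->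
  exists2 v, f.@[v] != 0 & forall c, c \in s -> (lin c).@[v] != 0.
Proof.
move=> f0 s0; have [v] := mpoly_nonroot (mulf_neq0 f0 (lin_prod_neq0 s0)).
rewrite mevalM => fsv; exists v => [|c cs].
  by apply: contraNneq fsv => ->; rewrite mul0r.
apply: contraNneq fsv => cv.
by rewrite rmorph_prod /= (big_rem c cs) /= cv mul0r mulr0.
Qed.

(** * The lower bound 5/2 from the quartics *)

Definition braid : seq (int * int * int) :=
  [:: (1, 0, 0); (0, 1, 0); (0, 0, 1); (1, -1, 0); (1, 0, -1); (0, 1, -1)].

Lemma symb_pow_lower d m f : f != 0 -> f \is d.-homog -> symb_pow J m f ->
  (5 * m <= 2 * d)%N.
Proof.
move=> f0 fd Jf; rewrite leqNgt; apply/negP => dm.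
have {}dm : (d * 4 < m * 10)%N by clear - dm; lia.
(* The three added lines join the nodes in pairs and are contracted by the Cremona involution.
   Together with [braid] they supply all factors of [r], [r - 1] and [k] below. *)
have [//|v fv Ev] := @generic_point f
   (braid ++ [:: (1, 1, -1); (1, -1, 1); (-1, 1, 1)]) f0.
set x0 := v 0 in Ev; set y0 := v 1 in Ev; set z0 := v 2%:R in Ev.
have X0 : x0 != 0.
  by have := Ev (1, 0, 0) isT; rewrite meval_lin /= mul1r !mul0r !addr0.
have Y0 : y0 != 0.
  by have := Ev (0, 1, 0) isT; rewrite meval_lin /= mul1r !mul0r addr0 add0r.
have Z0 : z0 != 0.
  by have := Ev (0, 0, 1) isT; rewrite meval_lin /= mul1r !mul0r !add0r.
have XY : y0 - x0 != 0.
  have := Ev (1, -1, 0) isT; rewrite meval_lin /=.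
  by rewrite mul1r mulN1r mul0r addr0 -oppr_eq0 opprB.
have XZ : z0 - x0 != 0.
  have := Ev (1, 0, -1) isT; rewrite meval_lin /=.
  by rewrite mul1r mulN1r mul0r addr0 -oppr_eq0 opprB.
have YZ : z0 - y0 != 0.
  have := Ev (0, 1, -1) isT; rewrite meval_lin /=.
  by rewrite mul1r mulN1r mul0r add0r -oppr_eq0 opprB.
have U0 : x0 + y0 - z0 != 0.
  by have := Ev (1, 1, -1) isT; rewrite meval_lin /= !mul1r mulN1r.
have V0 : x0 - y0 + z0 != 0.
  by have := Ev (1, -1, 1) isT; rewrite meval_lin /= !mul1r mulN1r.
have W0 : y0 + z0 - x0 != 0.
  by have := Ev (-1, 1, 1) isT; rewrite meval_lin /= !mul1r mulN1r -addrA addrC.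
(* [r] selects the quartic of the pencil through [v], [p : q] its parameter at [v]. *)
pose p := (x0 - y0 + z0) * (z0 - x0); pose q := (x0 + y0 - z0) * (y0 - x0).
pose r := (x0 - y0 + z0) ^+ 2 * y0 * (z0 - x0) /
          ((x0 + y0 - z0) ^+ 2 * z0 * (y0 - x0)).
(* The scalar between [v] and its parametrization; since [f] is homogeneous, it only has to be
   nonzero. *)
pose k := (y0 + z0 - x0) ^+ 3 * (x0 - y0 + z0) ^+ 3 * (z0 - y0) ^+ 2 *
  (z0 - x0) ^+ 2 / ((x0 + y0 - z0) * z0 ^+ 2).
have r0 : r != 0 by rewrite !mulf_neq0 ?invr_neq0 ?mulf_neq0 ?expf_neq0.
have r1 : r - 1 != 0.
  rewrite (_ : r - 1 = (y0 + z0 - x0) ^+ 2 * x0 * (z0 - y0) /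
     ((x0 + y0 - z0) ^+ 2 * z0 * (y0 - x0))).
    by rewrite !mulf_neq0 ?invr_neq0 ?mulf_neq0 ?expf_neq0.
  by rewrite /r; field; rewrite U0 Z0 XY.
have k0 : k != 0 by rewrite !mulf_neq0 ?invr_neq0 ?mulf_neq0 ?expf_neq0.
have quarticE i : quartic r p q i = k * v i.
  move: i; apply: ord3P; rewrite /quartic /vec /= -/x0 -/y0 -/z0 /r /p /q /k;
    field; by rewrite U0 Z0 XY.
have [||g [ts [sg uts sts ton [t0 [c [c0 gt0]]]]]] := @quartic_curve _ r p q r0.
- by rewrite -subr_eq0.
- by rewrite xpair_eqE mulf_eq0 (negbTE V0) (negbTE XZ).
have gf : mmap polyC g f = 0.
  by apply: (symb_pow_curve fd Jf sg uts ton); rewrite sts.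
move/(congr1 (fun p => p.[t0])): gf.
rewrite horner_mmap horner0 (meval_eq (v2 := fun i => (c * k) * v i)) => [|i].
  rewrite (meval_scale_homog _ _ fd) => /eqP.
  by rewrite mulf_eq0 expf_eq0 mulf_eq0 (negbTE c0) (negbTE k0) (negbTE fv) andbF.
by rewrite gt0 quarticE mulrA.
Qed.

(** * No form of degree below 6 in the second symbolic power *)

(** The line joining the points [S] and [T] also contains [S :|: T], at parameter 1/2; three double
    zeros exceed the degree. *)
Lemma vanish_on_line d f S T s t : f \is d.-homog -> symb_pow J 2 f -> (d < 6)%N ->
  S != set0 -> T != set0 -> [disjoint S & T] ->
  f.@[fun i => s * (i \in S)%:R + t * (i \in T)%:R] = 0.
Proof.
move=> fd Jf d6 S0 T0 dST.
have two0 : 2%:R != 0 :> C by rewrite pnatr_eq0.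
pose g i : {poly C} := (i \in S)%:R *: 'X + (i \in T)%:R *: (1 - 'X).
have sg i : (size (g i) <= 2)%N.
  rewrite (leq_trans (size_polyD _ _)) // geq_max !(leq_trans (size_scale_leq _ _)) ?size_polyX //.
  by rewrite (leq_trans (size_polyD _ _)) // size_polyN size_polyX size_poly1.
have gE c i : (g i).[c] = c * (i \in S)%:R + (1 - c) * (i \in T)%:R.
  by rewrite /g !hornerE [c * _]mulrC [(1 - c) * _]mulrC.
have gf : mmap polyC g f = 0.
  apply: (symb_pow_curve (ts := [:: 0; 1; 2%:R^-1]) fd Jf sg) => //; last by rewrite muln1.
    rewrite /= !inE !negb_or !andbT eq_sym oner_eq0 eq_sym invr_eq0 two0 /=.
    by rewrite eq_sym invr_eq1 (eqr_nat _ 2 1).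
  move=> c; rewrite !inE => /or3P[] /eqP->.
  - by exists T, 1; split=> [||i]; rewrite ?oner_eq0 // gE mul0r add0r subr0.
  - by exists S, 1; split=> [||i]; rewrite ?oner_eq0 // gE subrr mul0r addr0.
  exists (S :|: T), 2%:R^-1; split=> [||i]; rewrite ?invr_eq0 //.
    by rewrite setU_eq0 negb_and S0.
  rewrite gE (_ : 1 - 2%:R^-1 = 2%:R^-1); last by field.
  rewrite -mulrDr inE; have [iS|_] := boolP (i \in S); last by rewrite add0r.
  by rewrite (disjointFr dST iS) addr0.
have generic a : a + t != 0 -> f.@[fun i => a * (i \in S)%:R + t * (i \in T)%:R] = 0.
  move=> at0; rewrite (meval_eq (v2 := fun i => (a + t) * (g i).[a / (a + t)])).
    by rewrite (meval_scale_homog _ _ fd) -horner_mmap gf horner0 mulr0.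
  by move=> i; rewrite gE; field.
pose h := mmap polyC (fun i => (i \in S)%:R *: 'X + (t * (i \in T)%:R)%:P : {poly C}) f.
have hE a : h.[a] = f.@[fun i => a * (i \in S)%:R + t * (i \in T)%:R].
  by rewrite horner_mmap; apply: meval_eq => i; rewrite !hornerE [a * _]mulrC.
rewrite -hE; suff -> : h = 0 by rewrite horner0.
apply/eqP; apply: contraT => h0.
(* Homogeneity reaches only nonzero [s + t]; the factor ['X + t%:P] avoids the one excluded value,
   where [h] then vanishes as a zero polynomial. *)
have [|a] := @poly_nonroot _ (h * ('X + t%:P)).
  by rewrite mulf_neq0 // -size_poly_eq0 size_XaddC.
rewrite hornerM !hornerE mulf_eq0 negb_or => /andP[ha /generic].
by rewrite -hE => /eqP; rewrite (negbTE ha).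
Qed.

Definition bset (b : bool * bool * bool) : {set 'I_3} := [set i | vec b.1.1 b.1.2 b.2 i].

Lemma bset_neq0 b0 b1 b2 : b0 || b1 || b2 -> bset (b0, b1, b2) != set0.
Proof.
move=> b; apply/set0Pn.
by case/orP: b => [/orP[]|] b; [exists 0|exists 1|exists 2%:R]; rewrite inE.
Qed.

Lemma bset_disjoint b0 b1 b2 c0 c1 c2 : b0 && c0 = false -> b1 && c1 = false ->
  b2 && c2 = false -> [disjoint bset (b0, b1, b2) & bset (c0, c1, c2)].
Proof.
move=> bc0 bc1 bc2; rewrite -setI_eq0; apply/eqP/setP; apply: ord3P;
  by rewrite !inE /vec /= ?bc0 ?bc1 ?bc2.
Qed.

(** Each of the six lines is spanned by the indicator vectors of two disjoint sets. *)
Lemma braid_vanish d f c v : f \is d.-homog -> symb_pow J 2 f -> (d < 6)%N ->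
  c \in braid -> (lin c).@[v] = 0 -> f.@[v] = 0.
Proof.
move=> fd Jf d6 cb; rewrite meval_lin => cv.
have cover b0 b1 b2 c0 c1 c2 (s t : C) : b0 || b1 || b2 -> c0 || c1 || c2 ->
    [&& b0 && c0 == false, b1 && c1 == false & b2 && c2 == false] ->
    v 0 = s * b0%:R + t * c0%:R -> v 1 = s * b1%:R + t * c1%:R ->
    v 2%:R = s * b2%:R + t * c2%:R -> f.@[v] = 0.
  move=> b0N c0N /and3P[/eqP bc0 /eqP bc1 /eqP bc2] v0 v1 v2.
  rewrite -(vanish_on_line s t fd Jf d6 (bset_neq0 b0N) (bset_neq0 c0N)
    (bset_disjoint bc0 bc1 bc2)).
  by apply: meval_eq; apply: ord3P; rewrite !inE.
have eqv (a b : C) : a + - 1 * b = 0 -> a = b.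
  by move=> /eqP; rewrite mulN1r subr_eq0 => /eqP.
have sT (s t : C) : s = s * 1 + t * 0 by rewrite mulr1 mulr0 addr0.
have tT (s t : C) : t = s * 0 + t * 1 by rewrite mulr1 mulr0 add0r.
move: cb; rewrite !inE => cb; case/or4P: cb cv => [/eqP->|/eqP->|/eqP->|/or3P[] /eqP->] /=;
  rewrite !mul0r ?add0r ?addr0 ?mul1r => E.
- by apply: (cover false true false false false true (v 1) (v 2%:R));
    rewrite // E !mulr0 addr0.
- by apply: (cover true false false false false true (v 0) (v 2%:R));
    rewrite // E !mulr0 addr0.
- by apply: (cover true false false false true false (v 0) (v 1));
    rewrite // E !mulr0 addr0.
- by apply: (cover true true false false false true (v 0) (v 2%:R));
    rewrite // -(eqv _ _ E).
- by apply: (cover true false true false true false (v 0) (v 1));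
    rewrite // -(eqv _ _ E).
- by apply: (cover false true true true false false (v 1) (v 0));
    rewrite // -(eqv _ _ E).
Qed.

(** A line through a generic [v] meets the six lines at six distinct parameters, where [f] vanishes:
    too many for degree at most 5. *)
Lemma symb_pow2_lower d f : f != 0 -> f \is d.-homog -> symb_pow J 2 f -> (6 <= d)%N.
Proof.
move=> f0 fd Jf; rewrite leqNgt; apply/negP => d6.
(* [wt c] is the value of [c] at (1,3,9), a direction on none of the six lines. For [c], [c'] in
   [braid], [comb c c'] vanishes at [v] exactly when [v + t w] meets both lines at the same [t]. *)
pose wt (c : int * int * int) : int := c.1.1 + c.1.2 * 3 + c.2 * 9.
pose comb (c c' : int * int * int) :=
  (c.1.1 * wt c' - c'.1.1 * wt c, c.1.2 * wt c' - c'.1.2 * wt c, c.2 * wt c' - c'.2 * wt c).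
have [|v fv Ev] := generic_point
    (s := [seq comb c.1 c.2 | c <- [seq (c, c') | c <- braid, c' <- braid] & c.1 != c.2]) f0.
  by vm_compute.
pose w : 'I_3 -> C := vec 1 3%:R 9%:R.
have lw c : (lin c).@[w] = (wt c)%:~R.
  by rewrite meval_lin /w /vec /= mulr1 /wt !rmorphD !rmorphM.
have wt0 c : c \in braid -> (wt c)%:~R != 0 :> C.
  by rewrite intr_eq0; apply/allP: c.
pose g i : {poly C} := (v i)%:P + (w i) *: 'X.
have gE c t : (lin c).@[fun i => (g i).[t]] = (lin c).@[v] + (wt c)%:~R * t.
  by rewrite -lw !meval_lin !hornerE; ring.
pose tau c := - (lin c).@[v] / (wt c)%:~R.
have gf : mmap polyC g f = 0.
  apply: (@dvdp_exp_roots_eq0 _ 1 [seq tau c | c <- braid]).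
  - rewrite map_inj_in_uniq // => c c' cb c'b /eqP; rewrite eqr_div ?wt0 // => /eqP E.
    apply/eqP; apply: contraT => cc'.
    have /Ev/negP[] : comb c c' \in [seq comb c.1 c.2 |
        c <- [seq (c, c') | c <- braid, c' <- braid] & c.1 != c.2].
      apply/mapP; exists (c, c') => //; rewrite mem_filter cc' andTb.
      exact: allpairs_f.
    rewrite (_ : _.@[v] = (lin c).@[v] * (wt c')%:~R - (lin c').@[v] * (wt c)%:~R).
      by rewrite subr_eq0 -eqr_opp -!mulNr E.
    by rewrite !meval_lin /comb [_.1.1]/= [_.1.2]/= [_.2]/= !rmorphB !rmorphM; ring.
  - move=> _ /mapP[c cb ->]; rewrite expr1 dvdp_XsubCl /root horner_mmap.
    rewrite (braid_vanish fd Jf d6 cb) // gE /tau mulrC divfK ?wt0 //.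
    by rewrite addrN.
  - apply: leq_trans (size_mmap_homog (e := 1) fd _) _; last by rewrite muln1.
    move=> i; rewrite /g (leq_trans (size_polyD _ _)) // geq_max.
    by rewrite (leq_trans (size_polyC_leq1 _)) // (leq_trans (size_scale_leq _ _)) ?size_polyX.
case/negP: fv; rewrite -(meval_eq (v1 := fun i => (g i).[0])) => [|i].
  by rewrite -horner_mmap gf horner0.
by rewrite /g !hornerE.
Qed.

(** * Line arrangements for the upper bounds *)

Definition through (b : bool * bool * bool) (c : int * int * int) : bool :=
  c.1.1 *+ b.1.1 + c.1.2 *+ b.1.2 + c.2 *+ b.2 == 0.

Definition passes m (s : seq (int * int * int)) := forall b0 b1 b2,
  b0 || b1 || b2 -> (m <= count (through (b0, b1, b2)) s)%N.

Lemma passes_cat m n s t : passes m s -> passes n t -> passes (m + n) (s ++ t).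
Proof. by move=> ms nt b0 b1 b2 b; rewrite count_cat leq_add ?ms ?nt. Qed.

Lemma res_lin S c : through (0 \in S, 1 \in S, 2%:R \in S) c -> res S (lin c) = 0.
Proof.
rewrite /through /= => /eqP cS.
have E k (b : bool) : k%:~R * (b%:R *: 'X) = (k *+ b)%:~R * 'X :> {poly C}.
  by case: b; rewrite ?scale1r ?scale0r ?mulr0 ?mulr0n ?mul0r ?mulr1n.
rewrite /lin !rmorphD !rmorphM /= !rmorph_int !mmapX !mmap1U !E -!mulrDl -!rmorphD.
by rewrite cS mul0r.
Qed.

(** A line through the point [S] lies in [J] locally there, with a separator as denominator; the
    other lines contribute order 0. *)
Lemma loc_contract_lin_prod P m s : ass J P -> passes m s ->
  loc_contract J m P (\prod_(c <- s) lin c).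
Proof.
move=> assPJ ms; have [S S0 PS] := assP assPJ; have [primeP _] := assPJ.
have {ms} : (m <= count (through (0%R \in S, 1%R \in S, 2%:R%R \in S)) s)%N.
  apply: ms; have /set0Pn[j] := S0; move: j; apply: ord3P => ->; by rewrite ?orbT.
elim: s m => [|c s IH] m /=; first by rewrite leqn0 big_nil => /eqP->; exact: loc_contract0.
rewrite big_cons; have [cS|_] := boolP (through _ c); last first.
  by move=> /IH; exact: loc_contractM (loc_contract0 _ _ primeP).
case: m => [_|m]; first exact: loc_contract0.
rewrite ltnS => /IH; apply: (loc_contractM (m := 1)) => //.
have [g gS gT] := separator S0; exists g; split; first by move/PS/eqP; apply/negP.
apply/pow_ideal1/res_points_J => T _; rewrite rmorphM /=.
by have [->|/gT->] := eqVneq T S; rewrite ?(res_lin cS) ?mulr0 ?mul0r.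
Qed.

Lemma is_alpha_symb_pow m d s : (m != 1)%N -> passes m s -> (0, 0, 0) \notin s -> size s = d ->
  (forall f e, f != 0 -> f \is e.-homog -> symb_pow J m f -> (d <= e)%N) ->
  is_alpha (symb_pow J m) d.
Proof.
move=> m1 ms s0 <- lower; split; last by move=> f e Jf f0 fe; exact: lower fe Jf.
exists (\prod_(c <- s) lin c); split; [|exact: lin_prod_neq0|exact: lin_prod_homog].
by rewrite /symb_pow (negbTE m1) => P PJ; exact: loc_contract_lin_prod.
Qed.

Lemma alphaE (I : ideal R) d : is_alpha I d -> alpha I = d.
Proof.
move=> Id; have := ClassicalEpsilon.epsilon_spec (inhabits 0%N) (is_alpha I) (ex_intro _ d Id).
rewrite -/(alpha I); move: (alpha I) => e [[f [If f0 fe]] He].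
have [[g [Ig g0 gd]] Hd] := Id.
by apply/eqP; rewrite eqn_leq (He _ _ Ig g0 gd) (Hd _ _ If f0 fe).
Qed.

Definition cubic : seq (int * int * int) := [:: (0, 1, 0); (0, 0, 1); (0, 1, -1)].

Lemma cubic_passes : passes 1 cubic.
Proof. by case=> -[] []. Qed.

(* Outside [braid]: a degenerate conic through the three double points. *)
Definition octic := braid ++ [:: (1, 1, -1); (1, -1, 0)].

Lemma octic_passes : passes 3 octic.
Proof. by case=> -[] []. Qed.

(* Outside [braid]: a degenerate member of the pencil of quartics. *)
Definition decic := braid ++ [:: (0, 1, 0); (1, 0, -1); (1, -1, 1); (1, -1, 1)].

Lemma decic_passes : passes 4 decic.
Proof. by case=> -[] []. Qed.

(** Doubling [braid] gives order 6 at the four triple points and 4 at the three double points; each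
    of the latter lies on two of the last three lines. *)
Definition quindecic := braid ++ braid ++ [:: (1, 1, -1); (1, -1, 1); (-1, 1, 1)].

Lemma quindecic_passes : passes 6 quindecic.
Proof. by case=> -[] []. Qed.

(** [decic] gives [k = 2], [quindecic] gives [k = 3], and adding [decic] raises [k] by 2. *)
Lemma even_lines k : (2 <= k)%N ->
  exists s, [/\ passes (2 * k) s, (0, 0, 0) \notin s & size s = (5 * k)%N].
Proof.
have [n] := ubnP k; elim: n k => // n IH [|[|[|[|k]]]] // kn _.
- by exists decic; split=> //; exact: decic_passes.
- by exists quindecic; split=> //; exact: quindecic_passes.
have [|//|s [ps s0 zs]] := IH k.+2; first by lia.
exists (decic ++ s); split.
- by rewrite (_ : 2 * k.+4 = 4 + 2 * k.+2)%N; [exact: passes_cat decic_passes ps | lia].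
- by rewrite mem_cat negb_or s0.
- by rewrite size_cat zs [size decic]/=; lia.
Qed.

Lemma alpha_even k : (2 <= k)%N -> alpha (symb_pow J (2 * k)) = (5 * k)%N.
Proof.
move=> k2; have [s [ps s0 zs]] := even_lines k2.
apply/alphaE/(is_alpha_symb_pow _ ps s0 zs); first by lia.
by move=> f e f0 fe /(symb_pow_lower f0 fe); lia.
Qed.

(** The lower bound is 5 (2k + 1) / 2 rounded up. Adding [cubic] to the lines for [2 * k] attains it
    when [k >= 2]; [k = 1] needs [octic]. *)
Lemma alpha_odd k : alpha (symb_pow J (2 * k + 1)) = (5 * k + 3)%N.
Proof.
have lower f e : f != 0 -> f \is e.-homog -> symb_pow J (2 * k + 1) f -> (5 * k + 3 <= e)%N.
  by move=> f0 fe /(symb_pow_lower f0 fe); clear; lia.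
apply: alphaE; case: k lower => [|[|k]] lower.
(* For [k = 0] the symbolic power is [J] by definition, and the product of [cubic] is its first
   generator. *)
- split=> [|f e Jf f0 fe]; last exact: lower fe Jf.
  exists (\prod_(c <- cubic) lin c); split; [|exact: lin_prod_neq0|exact: lin_prod_homog].
  rewrite (_ : \prod_(c <- _) _ = y * z * (y - z)); first exact: Jyz.
  by rewrite /cubic !big_cons big_nil /lin /=; ring.
- exact: is_alpha_symb_pow octic_passes _ _ lower.
have [//|s [ps s0 zs]] := @even_lines k.+2.
apply: (is_alpha_symb_pow _ (passes_cat ps cubic_passes)) lower; first by lia.
- by rewrite mem_cat negb_or s0.
- by rewrite size_cat zs.
Qed.

Lemma alpha_2 : alpha (symb_pow J 2) = 6%N.
Proof.
apply/alphaE/(is_alpha_symb_pow (s := cubic ++ cubic)) => //.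
  exact: passes_cat cubic_passes cubic_passes.
by move=> f e f0 fe; exact: symb_pow2_lower.
Qed.

(** * The Waldschmidt constant *)

(** From [m = 4] on, past the exceptional exponent 2, [2 * a m] is [5 * m] or [5 * m + 1], so the
    quotient is within 1/m of 5/2. *)
Lemma waldschmidt_half (a : nat -> nat) :
  (forall k, (2 <= k)%N -> a (2 * k)%N = (5 * k)%N) ->
  (forall k, a (2 * k + 1)%N = (5 * k + 3)%N) ->
  forall eps : R, 0 < eps -> exists N : nat, forall m : nat, (0 < m)%N -> (N <= m)%N ->
    `| (a m)%:R / m%:R - 5%:R / 2%:R | < eps.
Proof.
move=> aeven aodd eps eps0; exists (maxn 4 (Num.bound (eps^-1))) => m m0.
rewrite geq_max => /andP[m4 mN].
have m0' : (0 : R) < m%:R by rewrite ltr0n.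
have meps : 1 / m%:R < eps.
  rewrite div1r -[eps]invrK ltf_pV2 ?posrE ?invr_gt0 //.
  apply: lt_le_trans (archi_boundP _) _; first by rewrite invr_ge0 ltW.
  by rewrite ler_nat.
apply: le_lt_trans meps.
have [b ab] : exists b : bool, (2 * a m = 5 * m + b)%N.
  have := odd_double_half m; case: (odd m) => Em.
    by exists true; rewrite -Em (_ : (true + _)%N = (2 * m./2 + 1)%N) ?aodd; lia.
  by exists false; rewrite -Em (_ : (false + _)%N = (2 * m./2)%N) ?aeven; lia.
rewrite (_ : _ - _ = b%:R / 2%:R / m%:R).
  rewrite !normrM !normfV !normr_nat ler_pM2r ?invr_gt0 //.
  by case: b {ab}; rewrite ?mul0r ?ler01 // ler_pdivrMr ?ltr0n // mul1r ler_nat.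
have := congr1 (fun n => n%:R : R) ab; rewrite natrM natrD natrM => E.
have -> : (a m)%:R = (5%:R * m%:R + b%:R) / 2%:R :> R by rewrite -E mulrC mulKf ?pnatr_eq0.
by field; rewrite lt0r_neq0.
Qed.

End Fano.

Theorem theorem4p1 (R : realType) :
  [/\ waldschmidt_is (@Jideal R) (5%:R / 2%:R),
      (forall k : nat, (2 <= k)%N -> alpha (symb_pow (@Jideal R) (2 * k)) = (5 * k)%N),
      (forall k : nat, alpha (symb_pow (@Jideal R) (2 * k + 1)) = (5 * k + 3)%N) &
      alpha (symb_pow (@Jideal R) 2) = 6%N].
Proof.
split; [|exact: alpha_even|exact: alpha_odd|exact: alpha_2].
exact: (waldschmidt_half (@alpha_even R) (@alpha_odd R)).
Qed.
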